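(* Let $G$ and $H$ be groups acting on each other compatibly. If $G$ and $H$ are finitely generated, then the non-abelian tensor product $G\otimes H$ is finitely generated if and only if $D_G(H)$ and $D_H(G)$ are finitely generated.
   Context: Groups act on themselves by conjugation on the left: ${}^{g}g'=gg'g^{-1}$. Let $G$ act on $H$ and $H$ act on $G$ by automorphisms (left actions, written ${}^{g}h$ and ${}^{h}g$). The mutual actions are compatible if ${}^{({}^{h}g)}h'={}^{hgh^{-1}}h'$ and ${}^{({}^{g}h)}g'={}^{ghg^{-1}}g'$ for all $g,g'\in G$, $h,h'\in H$, where ${}^{hgh^{-1}}h'$ means $h\cdot {}^{g}(h^{-1}h'h)\cdot h^{-1}$ and ${}^{ghg^{-1}}g'$ means $g\cdot {}^{h}(g^{-1}g'g)\cdot g^{-1}$. For compatible actions, the non-abelian tensor product $G\otimes H$ is the group generated by symbols $g\otimes h$ ($g\in G$, $h\in H$) with relations $gg'\otimes h=({}^{g}g'\otimes {}^{g}h)(g\otimes h)$ and $g\otimes hh'=(g\otimes h)({}^{h}g\otimes {}^{h}h')$ for all $g,g'\in G$, $h,h'\in H$. The derivative of $G$ by $H$ is the subgroup $D_H(G)=\langle g\cdot{}^{h}(g^{-1})\mid g\in G,\,h\in H\rangle$ of $G$; similarly $D_G(H)=\langle h\cdot{}^{g}(h^{-1})\mid g\in G,\,h\in H\rangle$ is a subgroup of $H$. *)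

(* Defs.v *)
From HB Require Import structures.
From mathcomp Require Import all_boot.
From mathcomp Require Import boolp classical_sets functions cardinality.

Set Implicit Arguments.
Unset Strict Implicit.
Unset Printing Implicit Defensive.

Local Open Scope quotient_scope.
Local Open Scope classical_set_scope.
Local Open Scope group_scope.

Definition is_subgroup (G : groupType) (K : set G) : Prop :=
  K 1 /\ forall x y : G, K x -> K y -> K (x * y^-1).

Definition generated (G : groupType) (S : set G) : set G :=
  smallest (@is_subgroup G) S.

(* For a subgroup [K] this does not depend on the ambient group: a generating
   set of [K] is automatically contained in [K]. *)
Definition finitely_generated (G : groupType) (K : set G) : Prop :=
  exists2 S : set G, finite_set S & generated S = K.

(* Group presentations. The letter [(x, false)] stands for the generator [x]
   and [(x, true)] for its formal inverse; [r u v] means that [u = v] is one of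
   the defining relations. *)
Definition word (X : choiceType) : choiceType := seq (X * bool).

Definition gen_word (X : choiceType) (x : X) : word X := [:: (x, false)].

Definition inv_word (X : choiceType) (w : word X) : word X :=
  rev [seq (l.1, ~~ l.2) | l <- w].

Inductive word_eq (X : choiceType) (r : word X -> word X -> Prop) :
    word X -> word X -> Prop :=
  | word_eq_refl u : word_eq r u u
  | word_eq_sym u v : word_eq r u v -> word_eq r v u
  | word_eq_trans u v w : word_eq r u v -> word_eq r v w -> word_eq r u w
  | word_eq_cat u u' v v' :
      word_eq r u u' -> word_eq r v v' -> word_eq r (u ++ v) (u' ++ v')
  | word_eq_cancel x b : word_eq r [:: (x, b); (x, ~~ b)] [::]
  | word_eq_rel u v : r u v -> word_eq r u v.

Section Presentation.
Variables (X : choiceType) (r : word X -> word X -> Prop).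

Definition word_eqb : rel (word X) := fun u v => `[< word_eq r u v >].

Lemma word_eqb_refl : reflexive word_eqb.
Proof. by move=> u; apply/asboolP; exact: word_eq_refl. Qed.

Lemma word_eqb_sym : symmetric word_eqb.
Proof. by move=> u v; apply/asboolP/asboolP; exact: word_eq_sym. Qed.

Lemma word_eqb_trans : transitive word_eqb.
Proof.
by move=> v u w /asboolP uv /asboolP vw; apply/asboolP/(word_eq_trans uv).
Qed.

Canonical word_eqb_equiv :=
  EquivRel word_eqb word_eqb_refl word_eqb_sym word_eqb_trans.

Definition presented := {eq_quot word_eqb}.

HB.instance Definition _ := Choice.on presented.
HB.instance Definition _ := EqQuotient.on presented.

Definition pr_class (w : word X) : presented := \pi_presented w.

Definition pr_gen (x : X) : presented := pr_class (gen_word x).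

Definition pr_one : presented := pr_class [::].
Definition pr_mul (p q : presented) : presented := pr_class (repr p ++ repr q).
Definition pr_inv (p : presented) : presented := pr_class (inv_word (repr p)).

Lemma pr_classP u v : pr_class u = pr_class v <-> word_eq r u v.
Proof.
split=> [uv|uv]; last by apply/eqP; rewrite eqmodE; apply/asboolP.
by apply/asboolP; rewrite -[`[< _ >]]/(word_eqb_equiv u v) -eqmodE; apply/eqP.
Qed.

Lemma word_eq_repr u : word_eq r (repr (pr_class u)) u.
Proof. by apply/pr_classP; rewrite /pr_class reprK. Qed.

Lemma inv_word_cat (u v : word X) :
  inv_word (u ++ v) = inv_word v ++ inv_word u.
Proof. by rewrite /inv_word map_cat rev_cat. Qed.

Lemma inv_wordK : involutive (@inv_word X).
Proof.
elim=> [//|[x b] u IH]; rewrite -cat1s inv_word_cat inv_word_cat IH.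
by rewrite /inv_word /= negbK.
Qed.

Lemma word_eqV (u : word X) : word_eq r (u ++ inv_word u) [::].
Proof.
elim: u => [|[x b] u IH]; first exact: word_eq_refl.
rewrite -cat1s inv_word_cat -catA [u ++ _]catA.
apply: word_eq_trans (word_eq_cancel r x b).
rewrite -[[:: (x, b); (x, ~~ b)]]/([:: (x, b)] ++ ([::] ++ [:: (x, ~~ b)])).
apply: word_eq_cat; first exact: word_eq_refl.
by apply: word_eq_cat => //; exact: word_eq_refl.
Qed.

Lemma word_Veq (u : word X) : word_eq r (inv_word u ++ u) [::].
Proof. by rewrite -[X in _ ++ X]inv_wordK; exact: word_eqV. Qed.

Lemma pr_mulE u v : pr_mul (pr_class u) (pr_class v) = pr_class (u ++ v).
Proof. by apply/pr_classP/word_eq_cat; exact: word_eq_repr. Qed.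

Lemma pr_mulA : associative pr_mul.
Proof.
move=> p q s; rewrite -[p]reprK -[q]reprK -[s]reprK.
by rewrite -!/(pr_class _) !pr_mulE catA.
Qed.

Lemma pr_1mul : left_id pr_one pr_mul.
Proof. by move=> p; rewrite -[p]reprK -/(pr_class _) pr_mulE. Qed.

Lemma pr_mul1 : right_id pr_one pr_mul.
Proof. by move=> p; rewrite -[p]reprK -/(pr_class _) pr_mulE cats0. Qed.

Lemma pr_Vmul : left_inverse pr_one pr_inv pr_mul.
Proof.
move=> p; rewrite -[X in pr_mul _ X]reprK -/(pr_class _) pr_mulE.
by apply/pr_classP; exact: word_Veq.
Qed.

Lemma pr_mulV : right_inverse pr_one pr_inv pr_mul.
Proof.
move=> p; rewrite -[X in pr_mul X _]reprK -/(pr_class _) pr_mulE.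
by apply/pr_classP; exact: word_eqV.
Qed.

HB.instance Definition _ :=
  isGroup.Build presented pr_mulA pr_1mul pr_mul1 pr_Vmul pr_mulV.

Lemma pr_rel u v : r u v -> pr_class u = pr_class v.
Proof. by move=> ruv; apply/pr_classP; exact: word_eq_rel. Qed.

Lemma pr_class_cat u v : pr_class (u ++ v) = pr_class u * pr_class v.
Proof. by rewrite -pr_mulE. Qed.

Lemma pr_class_invgen x : pr_class [:: (x, true)] = (pr_gen x)^-1.
Proof.
apply: (@mulIg presented (pr_gen x)).
rewrite mulVg -pr_class_cat; apply/pr_classP.
exact: (word_eq_cancel r x true).
Qed.

Section Universal.
Variables (K : groupType) (f : X -> K).

Definition word_eval (w : word X) : K :=
  foldr (fun l k => (if l.2 then (f l.1)^-1 else f l.1) * k) 1 w.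

Lemma word_eval_cat (u v : word X) :
  word_eval (u ++ v) = word_eval u * word_eval v.
Proof. by elim: u => [|l u IH] /=; rewrite ?mul1g // IH mulgA. Qed.

Lemma presented_universal :
  (forall u v, r u v -> word_eval u = word_eval v) ->
  exists! phi : presented -> K,
    {morph phi : p q / p * q} /\ forall x, phi (pr_gen x) = f x.
Proof.
move=> fr.
have eval_eq u v : word_eq r u v -> word_eval u = word_eval v.
  elim=> //.
  - by move=> u1 v1 w1 _ -> _ ->.
  - by move=> u1 u2 v1 v2 _ IHu _ IHv; rewrite !word_eval_cat IHu IHv.
  - by move=> x [] /=; rewrite mulg1 (mulVg, mulgV).
exists (fun p => word_eval (repr p)); split; first split.
- move=> p q; rewrite -word_eval_cat; apply: eval_eq; exact: word_eq_repr.
- by move=> x; rewrite (eval_eq _ _ (word_eq_repr _)) /= mulg1.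
move=> phi [phiM phiX]; apply/funext => p.
have phi1 : phi (pr_class [::]) = 1.
  by apply: (@mulgI K (phi (pr_class [::]))); rewrite -phiM -pr_class_cat mulg1.
have phiV q : phi q^-1 = (phi q)^-1.
  by apply: (@mulIg K (phi q)); rewrite -phiM !mulVg -phi1.
rewrite -[in RHS](reprK p) -/(pr_class _).
elim: (repr p) => [|[x b] w IH]; first by rewrite phi1.
rewrite -cat1s pr_class_cat phiM -IH word_eval_cat /= mulg1; congr (_ * _).
by case: b; rewrite ?pr_class_invgen ?phiV phiX.
Qed.

End Universal.

End Presentation.

(* [act g h] is the left action of [g] on [h]. *)
Definition acts_by_automorphisms (G H : groupType) (act : G -> H -> H) : Prop :=
  [/\ forall h, act 1 h = h,
      forall g g' h, act (g * g') h = act g (act g' h)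
    & forall g h h', act g (h * h') = act g h * act g h'].

Definition compatible (G H : groupType)
    (actGH : G -> H -> H) (actHG : H -> G -> G) : Prop :=
  (forall g h h',
     actGH (actHG h g) h' = h * actGH g (h^-1 * h' * h) * h^-1) /\
  (forall g g' h,
     actHG (actGH g h) g' = g * actHG h (g^-1 * g' * g) * g^-1).

Section TensorProduct.
Variables (G H : groupType) (actGH : G -> H -> H) (actHG : H -> G -> G).

Inductive tensor_rel : word (G * H)%type -> word (G * H)%type -> Prop :=
  | tensor_rel_mull g g' h :
      tensor_rel (gen_word (g * g', h))
                 (gen_word (g * g' * g^-1, actGH g h) ++ gen_word (g, h))
  | tensor_rel_mulr g h h' :
      tensor_rel (gen_word (g, h * h'))
                 (gen_word (g, h) ++ gen_word (actHG h g, h * h' * h^-1)).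

Definition tensor_product : groupType := presented tensor_rel.

Definition tensor (g : G) (h : H) : tensor_product := pr_gen tensor_rel (g, h).

Lemma tensor_mull g g' h :
  tensor (g * g') h = tensor (g * g' * g^-1) (actGH g h) * tensor g h.
Proof. by rewrite /tensor /pr_gen -pr_class_cat; apply/pr_rel; constructor. Qed.

Lemma tensor_mulr g h h' :
  tensor g (h * h') = tensor g h * tensor (actHG h g) (h * h' * h^-1).
Proof. by rewrite /tensor /pr_gen -pr_class_cat; apply/pr_rel; constructor. Qed.

End TensorProduct.

(* The derivative of [G] by [H], for an action [act] of [H] on [G]. *)
Definition derivative (G H : groupType) (act : H -> G -> G) : set G :=
  generated [set g * act h g^-1 | g in [set: G] & h in [set: H]].

(* Main.v *)
Require Import Defs.
From mathcomp Require Import all_boot.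
From mathcomp Require Import boolp classical_sets functions cardinality.

(** The group [T] = [G (x) H] maps to [H] by the boundary
    [d (g (x) h) = ^g h * h^-1], a homomorphism whose image is the derivative
    [D_G(H)]; the symmetric boundary maps [T] onto [D_H(G)].  So if [T] is
    finitely generated, both derivatives are.

    Conversely, [T] is generated by the translates of the [a (x) b], with [a]
    and [b] in finite generating sets [A] and [B] of [G] and [H], under the
    diagonal actions of [G] and [H].  It is therefore enough to find a finitely
    generated subgroup [N] that contains these [a (x) b] and is stable under
    both actions.  The crossed module structure of [T] says what is needed:
    [^g t = (g (x) d t) * t] ([tensor_boundary]), so [N] is stable under [G] as
    soon as it contains [g (x) x] for all [x] in [D_G(H)].  Conjugation by [t]
    is the action of [d t] ([tensor_conj]), which gives
    [g (x) (d t * x) = (g (x) d t) * t * (g (x) x) * t^-1]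
    ([tensor_boundary_mul]).  Hence, if [D_G(H)] is generated by the [d y] for
    finitely many [y], then putting in [N] these [y] and the [a (x) d y], for
    [a] in [A], is enough to have all of [a (x) D_G(H)] in [N]; passing from
    [A] to [G] is formal ([act_stable]).  The action of [H] is dealt with in
    the same way, because [h (x) g |-> (g (x) h)^-1] exchanges the roles of [G]
    and [H] ([is_tensor_swap]). *)

Set Implicit Arguments.
Unset Strict Implicit.
Unset Printing Implicit Defensive.

Local Open Scope classical_set_scope.
Local Open Scope group_scope.

(** * Subgroups, homomorphisms and finite generation *)

Section Morphism.
Variables (T K : groupType) (d : T -> K).
Hypothesis dM : {morph d : x y / x * y}.

Lemma morph_one : d 1 = 1.
Proof. by apply: (@mulgI _ (d 1)); rewrite -dM !mulg1. Qed.

Lemma morph_inv x : d x^-1 = (d x)^-1.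
Proof. by apply: (@mulgI _ (d x)); rewrite -dM !mulgV morph_one. Qed.

End Morphism.

Section Subgroup.
Variables (G : groupType) (K : set G).

Lemma is_subgroupI : K 1 -> (forall x y, K x -> K y -> K (x * y)) ->
  (forall x, K x -> K x^-1) -> is_subgroup K.
Proof. by move=> K1 KM KV; split=> // x y Kx Ky; apply/KM/KV. Qed.

Hypothesis subK : is_subgroup K.

Lemma subgroup1 : K 1. Proof. by case: subK. Qed.

Lemma subgroupV x : K x -> K x^-1.
Proof. by case: subK => K1 KB Kx; rewrite -[_^-1]mul1g; exact: KB. Qed.

Lemma subgroupM x y : K x -> K y -> K (x * y).
Proof.
move=> Kx Ky; rewrite -[y]invgK.
by case: subK => _ KB; apply: KB => //; exact: subgroupV.
Qed.

End Subgroup.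

Lemma generated_is_subgroup (G : groupType) (S : set G) :
  is_subgroup (generated S).
Proof.
split=> [L [[]] //|x y Sx Sy L LS].
by case: (LS) => [[_ LB] _]; apply: LB; [exact: Sx | exact: Sy].
Qed.

Lemma generated_ind (G : groupType) (S L : set G) :
  is_subgroup L -> S `<=` L -> generated S `<=` L.
Proof. exact: smallest_sub. Qed.

Section MorphismImage.
Variables (T K : groupType) (d : T -> K).
Hypothesis dM : {morph d : x y / x * y}.

Lemma image_generated (S : set T) : d @` generated S = generated (d @` S).
Proof.
have [gS gdS] := (generated_is_subgroup S, generated_is_subgroup (d @` S)).
apply/seteqP; split; last first.
  apply: generated_ind; last first.
    by apply: image_subset; exact: sub_gen_smallest.
  apply: is_subgroupI.
  - by exists 1; [exact: (subgroup1 gS) | exact: morph_one].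
  - move=> _ _ [x Sx <-] [y Sy <-].
    by exists (x * y); [exact: (subgroupM gS) | rewrite dM].
  - move=> _ [x Sx <-].
    by exists x^-1; [exact: (subgroupV gS) | rewrite morph_inv].
move=> _ [x Sx <-]; move: x Sx.
apply: (@generated_ind _ S (d @^-1` generated (d @` S))).
  apply: is_subgroupI => [|x y|x] /=.
  - by rewrite morph_one //; exact: (subgroup1 gdS).
  - by rewrite dM; exact: (subgroupM gdS).
  - by rewrite morph_inv //; exact: (subgroupV gdS).
by move=> x Sx; apply: sub_gen_smallest; exists x.
Qed.

Lemma finitely_generated_range :
  finitely_generated [set: T] -> finitely_generated (range d).
Proof.
move=> [S finS genS]; exists (d @` S); first exact: finite_image.
by rewrite -image_generated genS.
Qed.

Lemma lift_generators : finitely_generated (range d) ->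
  exists2 Y : set T, finite_set Y & d @` generated Y = range d.
Proof.
move=> [S finS genS].
have lift x : exists y, S x -> d y = x.
  have [Sx|nSx] := pselect (S x); last by exists 1 => /nSx.
  have : range d x by rewrite -genS; exact: sub_gen_smallest.
  by case=> y _ <-; exists y.
have {lift}[s sP] := choice lift.
exists (s @` S); first exact: finite_image.
rewrite image_generated image_comp -genS; congr generated.
apply/seteqP; split=> [_ [x Sx <-]|x Sx]; first by rewrite /= sP.
by exists x; rewrite //= sP.
Qed.

End MorphismImage.

(** * The universal property and its symmetry *)

Section Relations.
Variables (G H : groupType) (actGH : G -> H -> H) (actHG : H -> G -> G).

Definition tensor_relations (K : groupType) (f : G -> H -> K) : Prop :=
  (forall g g' h, f (g * g') h = f (g * g' * g^-1) (actGH g h) * f g h) /\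
  (forall g h h', f g (h * h') = f g h * f (actHG h g) (h * h' * h^-1)).

(** Working with any group that has the universal property, rather than with
    the presentation, is what makes the symmetry between [G] and [H] usable:
    one group is at the same time a tensor product of [G] and [H] and a tensor
    product of [H] and [G]. *)
Record is_tensor (T : groupType) (tau : G -> H -> T) : Prop := IsTensor {
  is_tensor_relations : tensor_relations tau;
  is_tensor_ind : forall P : set T,
    is_subgroup P -> (forall g h, P (tau g h)) -> forall t, P t;
  is_tensor_universal : forall (K : groupType) (f : G -> H -> K),
    tensor_relations f -> exists2 phi : T -> K,
      {morph phi : x y / x * y} & forall g h, phi (tau g h) = f g h
}.

Lemma tensor_product_is_tensor : is_tensor (tensor actGH actHG).
Proof.
split.
- by split; [exact: tensor_mull | exact: tensor_mulr].
- move=> P subP Ptau t; rewrite -[t]reprK -/(pr_class _ _).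
  elim: (repr t) => [|[[g h] b] w IH]; first exact: (subgroup1 subP).
  rewrite -cat1s pr_class_cat; apply: (subgroupM subP) => //.
  case: b; last exact: Ptau.
  by rewrite pr_class_invgen; apply: (subgroupV subP); exact: Ptau.
- move=> K f [fl fr].
  have frel u v : tensor_rel actGH actHG u v ->
      word_eval (fun x => f x.1 x.2) u = word_eval (fun x => f x.1 x.2) v.
    by case=> [g g' h|g h h'] /=; rewrite !mulg1 (fl, fr).
  have [phi [[phiM phiE] _]] := presented_universal frel.
  by exists phi => // g h; exact: (phiE (g, h)).
Qed.

End Relations.

Lemma compatible_swap (G H : groupType)
    (actGH : G -> H -> H) (actHG : H -> G -> G) :
  compatible actGH actHG -> compatible actHG actGH.
Proof. by move=> [compG compH]; split=> *; [exact: compH | exact: compG]. Qed.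

(** Inversion reverses the factors on the right of each relation, and so turns
    the relation that expands [g * g'] into the one that expands the second
    argument of a pairing of [H] and [G]. *)
Lemma is_tensor_swap (G H : groupType)
    (actGH : G -> H -> H) (actHG : H -> G -> G)
    (T : groupType) (tau : G -> H -> T) :
  is_tensor actGH actHG tau ->
  is_tensor actHG actGH (fun h g => (tau g h)^-1).
Proof.
move=> [[taul taur] tau_ind tau_univ]; split.
- by split=> [h h' g|h g g']; rewrite (taul, taur) invgM.
- move=> P subP Ptau; apply: tau_ind => // g h.
  by rewrite -[tau g h]invgK; exact: (subgroupV subP).
- move=> K f [fl fr].
  have [|phi phiM phiE] := tau_univ K (fun g h => (f h g)^-1).
    by split=> [g g' h|g h h']; rewrite (fl, fr) invgM.
  by exists phi => // h g; rewrite morph_inv // phiE invgK.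
Qed.

(** * The crossed module structure of a tensor product *)

Section Action.
Variables (G H : groupType) (act : G -> H -> H).
Hypothesis act_aut : acts_by_automorphisms act.

Lemma aut1 h : act 1 h = h. Proof. by case: act_aut. Qed.
Lemma autM g g' h : act (g * g') h = act g (act g' h).
Proof. by case: act_aut. Qed.
Lemma aut_mul g h h' : act g (h * h') = act g h * act g h'.
Proof. by case: act_aut. Qed.
Lemma aut_inv g h : act g h^-1 = (act g h)^-1.
Proof. by apply: (@morph_inv _ _ (act g)) => x y; exact: aut_mul. Qed.
Lemma autKV g h : act g (act g^-1 h) = h.
Proof. by rewrite -autM mulgV aut1. Qed.
Lemma autK g h : act g^-1 (act g h) = h.
Proof. by rewrite -autM mulVg aut1. Qed.

End Action.

Section CrossedModule.
Variables (G H : groupType) (actGH : G -> H -> H) (actHG : H -> G -> G).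
Hypothesis actGH_aut : acts_by_automorphisms actGH.
Hypothesis actHG_aut : acts_by_automorphisms actHG.
Hypothesis act_compat : compatible actGH actHG.
Variables (T : groupType) (tau : G -> H -> T).
Hypothesis tauP : is_tensor actGH actHG tau.

Lemma compat_GH g h h' :
  actGH (actHG h g) (h * h' * h^-1) = h * actGH g h' * h^-1.
Proof. by case: act_compat => -> _; rewrite -!mulgA mulKg mulVg mulg1. Qed.

Lemma compat_HG g h g' :
  actHG (actGH g h) (g * g' * g^-1) = g * actHG h g' * g^-1.
Proof. by case: act_compat => _ ->; rewrite -!mulgA mulKg mulVg mulg1. Qed.

Lemma boundary_exists : exists2 d : T -> H,
  {morph d : x y / x * y} & forall g h, d (tau g h) = actGH g h * h^-1.
Proof.
apply: (is_tensor_universal tauP); split=> [g g' h|g h h'].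
  by rewrite !(autM actGH_aut) (autK actGH_aut) mulgA mulgVK.
rewrite compat_GH (aut_mul actGH_aut) !invgM invgK !mulgA.
by rewrite !mulgVK.
Qed.

(** The diagonal map of [g] preserves the relation expanding [h * h'] because
    compatibility makes it commute with the action of [H] on [G]: [^g h] acts
    on conjugates by [g] as [h] does, followed by conjugation by [g]. *)
Lemma diagonal_action_exists : exists2 act : G -> T -> T,
  forall g, {morph act g : x y / x * y} &
  forall g g' h, act g (tau g' h) = tau (g * g' * g^-1) (actGH g h).
Proof.
have act g : exists phi : T -> T, {morph phi : x y / x * y} /\
    forall g' h, phi (tau g' h) = tau (g * g' * g^-1) (actGH g h).
  have [taul taur] := is_tensor_relations tauP.
  have [|phi phiM phiE] := is_tensor_universal tauP
    (f := fun g' h => tau (g * g' * g^-1) (actGH g h)); last by exists phi.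
  split=> [k k' h|k h h'].
    rewrite -[g * (k * k') * _](_ : (g * k * g^-1) * (g * k' * g^-1) = _);
      last by rewrite !mulgA mulgVK.
    rewrite taul -!(autM actGH_aut) !invgM invgK.
    by rewrite !mulgA !mulgVK.
  rewrite (aut_mul actGH_aut) taur compat_HG.
  by rewrite !(aut_mul actGH_aut) (aut_inv actGH_aut).
by have [phi phiP] := choice act; exists phi => g; case: (phiP g).
Qed.

Variable d : T -> H.
Hypothesis dM : {morph d : x y / x * y}.
Hypothesis dE : forall g h, d (tau g h) = actGH g h * h^-1.
Variable act : G -> T -> T.
Hypothesis actM : forall g, {morph act g : x y / x * y}.
Hypothesis actE :
  forall g g' h, act g (tau g' h) = tau (g * g' * g^-1) (actGH g h).

Lemma tensor_mull_act g g' h : tau (g * g') h = act g (tau g' h) * tau g h.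
Proof. by rewrite actE; have [-> _] := is_tensor_relations tauP. Qed.

Lemma tensor1l h : tau 1 h = 1.
Proof.
apply: (@mulgI _ (act 1 (tau 1 h))); rewrite -tensor_mull_act mul1g mulg1.
by rewrite actE invg1 !mulg1 aut1.
Qed.

Lemma tensor1r g : tau g 1 = 1.
Proof.
have [_ taur] := is_tensor_relations tauP.
apply: (@mulgI _ (tau g 1)); rewrite mulg1 -[in RHS](mul1g 1) taur.
by rewrite invg1 !mulg1 (aut1 actHG_aut).
Qed.

Lemma tensorVl g h : tau g^-1 h = (tau g (actGH g^-1 h))^-1.
Proof.
apply/esym/mulg1_eq; rewrite -[RHS](tensor1l h) -(mulVg g) tensor_mull_act.
by rewrite actE invgK mulVg mul1g.
Qed.

Lemma boundary_act g t : d (act g t) = actGH g (d t).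
Proof.
apply: (is_tensor_ind tauP (P := [set t | d (act g t) = actGH g (d t)])).
  apply: is_subgroupI => /= [|x y|x].
  - by rewrite !morph_one //; exact: aut_mul.
  - by rewrite actM !dM (aut_mul actGH_aut) => -> ->.
  - by rewrite (morph_inv (actM g)) !(morph_inv dM) (aut_inv actGH_aut) => ->.
move=> g' h /=; rewrite actE !dE -(autM actGH_aut) (aut_mul actGH_aut).
by rewrite mulgVK (autM actGH_aut) (aut_inv actGH_aut).
Qed.

Lemma range_boundary : range d = derivative actGH.
Proof.
apply/seteqP; split=> [_ [t _ <-]|].
  have gD := generated_is_subgroup
    [set g * actGH h g^-1 | g in [set: H] & h in [set: G]].
  apply: (is_tensor_ind tauP (P := d @^-1` derivative actGH)) t.
    apply: is_subgroupI => /= [|x y|x].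
    - by rewrite (morph_one dM); exact: (subgroup1 gD).
    - by rewrite dM; exact: (subgroupM gD).
    - by rewrite (morph_inv dM); exact: (subgroupV gD).
  move=> g h /=; rewrite dE -[_ * _]invgK invgM invgK -(aut_inv actGH_aut).
  apply: (subgroupV gD); apply: sub_gen_smallest.
  by exists h => //; exists g.
apply: generated_ind.
  apply: is_subgroupI.
  - by exists 1 => //; exact: morph_one.
  - by move=> _ _ [x _ <-] [y _ <-]; exists (x * y).
  - by move=> _ [x _ <-]; exists x^-1 => //; exact: morph_inv.
move=> _ [h _ [g _ <-]]; exists (tau g h)^-1 => //.
by rewrite (morph_inv dM) dE invgM invgK (aut_inv actGH_aut).
Qed.

(** Expanding [(g * g') (x) (h * h')] by the two relations, in either order,
    gives two products whose outer factors agree; with [k] for [g * g' * g^-1]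
    and [l] for [^g h'], this is what is left of them. *)
Lemma tensor_exchange g h k l :
  tau (actHG (actGH g h) k) (actGH g h * l * (actGH g h)^-1) * tau g h =
  tau g h * tau (actHG h k) (h * l * h^-1).
Proof.
have [taul taur] := is_tensor_relations tauP.
set g' := g^-1 * k * g; set h' := actGH g^-1 l.
have Ek : g * g' * g^-1 = k by rewrite /g' !mulgA mulgV mul1g mulgK.
have El : actGH g h' = l by rewrite autKV.
have mulE : tau (g * g') (h * h') =
    tau k (actGH g h) *
    tau (actHG (actGH g h) k) (actGH g h * l * (actGH g h)^-1) *
    (tau g h * tau (actHG h g) (h * h' * h^-1)).
  by rewrite taul Ek (aut_mul actGH_aut) El taur (taur g).
have mulE' : tau (g * g') (h * h') =
    tau k (actGH g h) * tau g h *
    (tau (actHG h k) (h * l * h^-1) * tau (actHG h g) (h * h' * h^-1)).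
  rewrite taur taul Ek (aut_mul actHG_aut) taul compat_GH El.
  by rewrite -(aut_inv actHG_aut) -!(aut_mul actHG_aut) Ek.
move: mulE; rewrite mulE' => /esym.
by rewrite !mulgA => /mulIg; rewrite -!mulgA => /mulgI.
Qed.

(** Conjugation by [t] is the diagonal action of [d t] (the Peiffer identity).
    For [t = g (x) h] it is [tensor_exchange] at the arguments that the action
    of [h] sends to the given ones. *)
Lemma tensor_conj t g h :
  t * tau g h * t^-1 = tau (actHG (d t) g) (d t * h * (d t)^-1).
Proof.
apply: (is_tensor_ind tauP (P := [set t | forall g h,
  t * tau g h * t^-1 = tau (actHG (d t) g) (d t * h * (d t)^-1)])) t g h.
  apply: is_subgroupI => /= [g h|x y cx cy g h|x cx g h].
  - by rewrite (morph_one dM) (aut1 actHG_aut) !invg1 !mulg1 !mul1g.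
  - have -> : x * y * tau g h * (x * y)^-1 = x * (y * tau g h * y^-1) * x^-1.
      by rewrite invgM !mulgA.
    by rewrite cy cx dM (autM actHG_aut) invgM !mulgA.
  - rewrite (morph_inv dM) invgK.
    rewrite -{1}(autKV actHG_aut (d x) g).
    rewrite -{1}[h](_ : d x * ((d x)^-1 * h * d x) * (d x)^-1 = h); last first.
      by rewrite !mulgA mulgV mul1g mulgK.
    by rewrite -cx !mulgA mulVg mul1g mulgVK invgK.
move=> g h g0 h0.
have := tensor_exchange g h (actHG h^-1 g0) (h^-1 * h0 * h).
rewrite autKV // -(autM actHG_aut).
rewrite (_ : h * (h^-1 * h0 * h) * h^-1 = h0); last first.
  by rewrite !mulgA mulgV mul1g mulgK.
by rewrite dE => <-; rewrite mulgK invgM invgK !mulgA.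
Qed.

Lemma tensor_boundary_mul g t h :
  tau g (d t * h) = tau g (d t) * (t * tau g h * t^-1).
Proof. by have [_ ->] := is_tensor_relations tauP; rewrite tensor_conj. Qed.

(** On a generator [t = g' (x) h] one has [d t * h = ^g' h], and [g (x) ^g' h]
    appears when [(g * g') (x) h] is expanded along the factorisation
    [g' * (g'^-1 * g * g')]; expanding along [g * g'] as well gives its value. *)
Lemma tensor_boundary g t : tau g (d t) = act g t * t^-1.
Proof.
apply: (is_tensor_ind tauP (P := [set t | tau g (d t) = act g t * t^-1])).
  apply: is_subgroupI => /= [|x y|x tx].
  - by rewrite (morph_one dM) (morph_one (actM g)) tensor1r mulgV.
  - move=> tx ty; rewrite dM tensor_boundary_mul tx ty actM invgM.
    by rewrite !mulgA mulgVK.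
  - have := tensor_boundary_mul g x (d x^-1).
    rewrite -dM mulgV (morph_one dM) tensor1r tx !mulgA mulgVK.
    move/esym/divg1_eq => E; apply: (@mulgI _ (act g x)).
    by rewrite E (morph_inv (actM g)) invgK mulVKg.
move=> g' h /=.
have Ed : d (tau g' h) * h = actGH g' h by rewrite dE mulgVK.
have : tau (g' * (g'^-1 * g * g')) h = tau (g * g') h.
  by rewrite !mulgA mulgV mul1g.
rewrite (tensor_mull_act g') (tensor_mull_act g) (actE g').
rewrite !mulgA mulgV mul1g mulgK -Ed.
by rewrite tensor_boundary_mul mulgA mulgVK mulgA => /mulIg <-; rewrite mulgK.
Qed.

(** * Stable subgroups *)

Section StableSubgroup.
Variables (A : set G) (N : set T).
Hypothesis genA : generated A = [set: G].
Hypothesis subN : is_subgroup N.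

(** Since [N] contains [Y], the identity [tensor_boundary_mul] lets one go
    through the words in [Y] and their inverses one letter at a time. *)
Lemma tensor_generated_boundary a (Y : set T) :
  Y `<=` N -> (forall y, Y y -> N (tau a (d y))) ->
  forall t, generated Y t -> N (tau a (d t)).
Proof.
move=> YN aY t Yt.
suff [] : N t /\ N (tau a (d t)) by [].
move: t Yt; apply: (@generated_ind _ Y [set t | N t /\ N (tau a (d t))]).
  apply: is_subgroupI => /= [|x y [Nx Nax] [Ny Nay]|x [Nx Nax]].
  - by rewrite (morph_one dM) tensor1r; split; exact: (subgroup1 subN).
  - split; first exact: (subgroupM subN).
    rewrite dM tensor_boundary_mul.
    by do 3?apply: (subgroupM subN) => //; exact: (subgroupV subN).
  - split; first exact: (subgroupV subN).
    have := tensor_boundary_mul a x (d x^-1).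
    rewrite -dM mulgV (morph_one dM) tensor1r => /esym/mulg1_eq E.
    have -> : tau a (d x^-1) = x^-1 * (tau a (d x))^-1 * x.
      by rewrite E !mulgA mulVg mul1g mulgVK.
    by do 2?apply: (subgroupM subN) => //; exact: (subgroupV subN).
by move=> y Yy; split; [exact: YN | exact: aY].
Qed.

(** By [tensor_boundary], stability under [g] follows from [g (x) D_G(H)] lying
    in [N], and the [g] with this property form a subgroup because [D_G(H)] is
    itself stable under [G] ([boundary_act]). *)
Lemma act_stable (Y : set T) :
  d @` generated Y = range d -> Y `<=` N ->
  (forall a y, A a -> Y y -> N (tau a (d y))) ->
  forall g t, N t -> N (act g t).
Proof.
move=> genY YN AY.
suff NG g t : N (tau g (d t)).
  move=> g t Nt; rewrite -[act g t](mulgVK t) -tensor_boundary.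
  exact: (subgroupM subN).
have Ag : generated A g by rewrite genA.
move: g Ag t; apply: (@generated_ind _ A [set g | forall t, N (tau g (d t))]).
  apply: is_subgroupI => /= [t|g g' Ng Ng' t|g Ng t].
  - by rewrite tensor1l; exact: (subgroup1 subN).
  - rewrite tensor_mull_act -[act g _](mulgVK (tau g' (d t))) -tensor_boundary.
    by do 2?apply: (subgroupM subN).
  - by rewrite tensorVl -boundary_act; apply: (subgroupV subN).
move=> a Aa t.
have [y Yy <-] : (d @` generated Y) (d t) by rewrite genY; exists t.
by apply: tensor_generated_boundary Yy => // z Yz; exact: AY.
Qed.

Lemma act_stable_generators h : (forall g t, N t -> N (act g t)) ->
  (forall a, A a -> N (tau a h)) -> forall g, N (tau g h).
Proof.
move=> Nact NA g.
have : generated A g by rewrite genA.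
move: g; apply: (@generated_ind _ A [set g | N (tau g h)]) => //.
apply: is_subgroupI => /= [|g g' Ng Ng'|g Ng].
- by rewrite tensor1l; exact: (subgroup1 subN).
- by rewrite tensor_mull_act; apply: (subgroupM subN) => //; exact: Nact.
- rewrite tensorVl; apply: (subgroupV subN) => //.
  have := Nact g^-1 _ Ng.
  by rewrite actE invgK mulVg mul1g.
Qed.

End StableSubgroup.

End CrossedModule.

(** * Finite generation of the tensor product *)

Theorem proposition5p1 (G H : groupType)
    (actGH : G -> H -> H) (actHG : H -> G -> G)
    (actGH_aut : acts_by_automorphisms actGH)
    (actHG_aut : acts_by_automorphisms actHG)
    (act_compat : compatible actGH actHG)
    (fgG : finitely_generated [set: G]%classic)
    (fgH : finitely_generated [set: H]%classic) :
  finitely_generated [set: tensor_product actGH actHG]%classic <->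
  finitely_generated (derivative actGH) /\
  finitely_generated (derivative actHG).
Proof.
have tauP := tensor_product_is_tensor actGH actHG.
move: (tensor_product actGH actHG) (tensor actGH actHG) tauP => T tau tauP.
have tauP' := is_tensor_swap tauP.
have compat' := compatible_swap act_compat.
have [d dM dE] := boundary_exists actGH_aut act_compat tauP.
have [e eM eE] := boundary_exists actHG_aut compat' tauP'.
rewrite -(range_boundary actGH_aut tauP dM dE).
rewrite -(range_boundary actHG_aut tauP' eM eE).
split=> [fgT|[fgd fge]]; first by split; exact: finitely_generated_range.
have [act actM actE] := diagonal_action_exists actGH_aut act_compat tauP.
have [bct bctM bctE] := diagonal_action_exists actHG_aut compat' tauP'.
have [[A finA genA] [B finB genB]] := (fgG, fgH).
have [Y finY genY] := lift_generators dM fgd.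
have [Z finZ genZ] := lift_generators eM fge.
pose S := [set tau a b | a in A & b in B] `|` (Y `|` Z) `|`
  ([set tau a (d y) | a in A & y in Y] `|`
   [set (tau (e z) b)^-1 | b in B & z in Z]).
have finS : finite_set S.
  by rewrite !finite_setU; do ![split]; try exact: finite_image2.
have subN := generated_is_subgroup S.
have SN : S `<=` generated S := @sub_gen_smallest _ _ S.
have Nact : forall g t, generated S t -> generated S (act g t).
  apply: (act_stable actGH_aut actHG_aut act_compat tauP dM dE actM actE
    genA subN genY).
  - by move=> y Yy; apply: SN; left; right; left.
  - by move=> a y Aa Yy; apply: SN; right; left; exists a => //; exists y.
have Nbct : forall h t, generated S t -> generated S (bct h t).
  apply: (act_stable actHG_aut actGH_aut compat' tauP' eM eE bctM bctE
    genB subN genZ).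
  - by move=> z Zz; apply: SN; left; right; right.
  - by move=> b z Bb Zz; apply: SN; right; right; exists b => //; exists z.
exists S => //; apply/seteqP; split=> // t _.
apply: (is_tensor_ind tauP) => // g h; rewrite -[tau g h]invgK.
apply: (subgroupV subN).
apply: (act_stable_generators actHG_aut tauP' bctE genB subN Nbct) => b Bb.
apply: (subgroupV subN).
apply: (act_stable_generators actGH_aut tauP actE genA subN Nact) => a Aa.
by apply: SN; left; left; exists a => //; exists b.
Qed.
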